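(* Let $R$ be a potent ring with Jacobson radical $J(R)$. Then the following six conditions are equivalent: (1) $R$ is a 2-UQ ring. (2) $R/J(R)$ is a 2-UQ ring. (3) $R/J(R)$ is a tripotent ring. (4) $R$ is a 2-UJ ring. (5) $R/J(R)$ is a 2-UJ ring. (6) $R/J(R)$ is a 2-UU ring.
   Context: Rings are associative with unity, not necessarily commutative. $U(R)$ is the set of units, $Nil(R)$ the set of nilpotent elements and $J(R)$ the Jacobson radical of $R$. An element $a\in R$ is quasi-nilpotent if $1-ax$ is invertible for every $x\in R$ with $ax=xa$; $QN(R)$ is the set of quasi-nilpotent elements. $R$ is 2-UQ if the square of each unit is the sum of an idempotent and a quasi-nilpotent element that commute with each other; equivalently, for each $u\in U(R)$, $u^2=1+q$ with $q\in QN(R)$. $R$ is 2-UJ if $u^2\in 1+J(R)$ for every $u\in U(R)$. $R$ is 2-UU if $u^2\in 1+Nil(R)$ for every $u\in U(R)$. $R$ is tripotent if $a^3=a$ for all $a\in R$. $R$ is semi-potent if every one-sided ideal not contained in $J(R)$ contains a non-zero idempotent; $R$ is potent if it is semi-potent and all idempotents lift modulo $J(R)$. *)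

(* Defs.v *)
From HB Require Import structures.
From mathcomp Require Import all_boot all_algebra.
From mathcomp Require Import boolp classical_sets.

Set Implicit Arguments.
Unset Strict Implicit.
Unset Printing Implicit Defensive.

Import GRing.Theory.
Local Open Scope ring_scope.
Local Open Scope quotient_scope.
Local Open Scope classical_set_scope.

(* Rings are of type pzRingType: associative, unital, not necessarily
   commutative, the zero ring being allowed. *)

Section Ideals.
Variable R : pzRingType.
Implicit Types I M : set R.

Definition left_ideal I : Prop :=
  [/\ I 0, (forall x y, I x -> I y -> I (x - y)) &
      (forall r x, I x -> I (r * x))].

Definition right_ideal I : Prop :=
  [/\ I 0, (forall x y, I x -> I y -> I (x - y)) &
      (forall r x, I x -> I (x * r))].

Definition maximal_left_ideal M : Prop :=
  [/\ left_ideal M, M <> setT &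
      (forall I, left_ideal I -> M `<=` I -> I = M \/ I = setT)].

Definition jacobson : set R :=
  [set x | forall M, maximal_left_ideal M -> M x].

Lemma jacobson_left_ideal : left_ideal jacobson.
Proof.
split=> [M [[]]//|x y Jx Jy M maxM|r x Jx M maxM];
  have [[_ MB MM] _ _] := maxM.
- by apply: MB; [apply: Jx | apply: Jy].
- by apply: MM; apply: Jx.
Qed.

(* If r is not in the maximal left ideal M, then {x | x * r \in M} is again a
   maximal left ideal. *)
Lemma maximal_left_ideal_colon M r : maximal_left_ideal M -> ~ M r ->
  maximal_left_ideal [set x | M (x * r)].
Proof.
move=> [[M0 MB MM] MT Mmax] nMr; split.
- split=> [|x y /= Mx My|s x /= Mx].
  + by rewrite /= mul0r.
  + by rewrite mulrBl; apply: MB.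
  + by rewrite -mulrA; apply: MM.
- by move=> eqT; apply: nMr; rewrite -[r]mul1r -[M _]/([set x | M (x * r)] 1) eqT.
move=> I [I0 IB IM] subI; have [IsubM|] := pselect (I `<=` [set x | M (x * r)]).
  by left; apply/seteqP.
move=> /existsNP[n /not_implyP[In nMnr]]; right; apply/seteqP; split=> // y _.
pose K := [set z : R | exists s, M (z - s * (n * r))].
have KI : left_ideal K.
  split=> [|x z [s Ms] [t Mt]|t x [s Ms]].
  - by exists 0; rewrite mul0r subrr.
  - exists (s - t); have := MB _ _ Ms Mt.
    by rewrite mulrBl !opprD !opprK !addrA [x - _ - z]addrAC.
  - by exists (t * s); rewrite -mulrA -mulrBr; apply: MM.
have subK : M `<=` K by move=> x Mx; exists 0; rewrite mul0r subr0.
case: (Mmax K KI subK) => [KM|KT].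
  case: nMnr; rewrite /= -KM.
  by exists 1; rewrite mul1r subrr.
have [s] : K (y * r) by rewrite KT.
rewrite mulrA -mulrBl => /subI Iysn.
have := IB _ _ Iysn (IB _ _ I0 (IM s n In)).
by rewrite sub0r opprK subrK.
Qed.

Lemma jacobson_right_ideal : right_ideal jacobson.
Proof.
have [J0 JB JM] := jacobson_left_ideal; split=> // r x Jx M maxM.
have [Mr|nMr] := pselect (M r); first by case: maxM => [[_ _ MM] _ _]; apply: MM.
exact: Jx (maximal_left_ideal_colon maxM nMr).
Qed.

Definition jacobsonb : {pred R} := fun x => `[< jacobson x >].

Lemma jacobsonb_zmod_closed : zmod_closed jacobsonb.
Proof.
have [J0 JB _] := jacobson_left_ideal.
by split=> [|x y /asboolP Jx /asboolP Jy]; apply/asboolP=> //; apply: JB.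
Qed.

HB.instance Definition _ :=
  GRing.isZmodClosed.Build R jacobsonb jacobsonb_zmod_closed.

End Ideals.

(* The quotient ring R / J(R).  The additive structure is the library's
   quotient of a Z-module by a subgroup; the library only multiplies cosets
   over commutative rings. *)
Definition jacobson_quot (R : pzRingType) := Quotient.quot (@jacobsonb R).

Section JacobsonQuotient.
Variable R : pzRingType.
Local Notation Q := (jacobson_quot R).

HB.instance Definition _ := Choice.on Q.
HB.instance Definition _ := GRing.Zmodule.on Q.
HB.instance Definition _ : EqQuotient R _ Q := EqQuotient.on Q.
HB.instance Definition _ := ZmodQuotient.on Q.

Lemma jacobson_quot_eqP (x y : R) : \pi_Q x = \pi_Q y <-> jacobson (x - y).
Proof.
split=> [/eqP|Jxy]; last apply/eqP.
  by rewrite -[_ == _]Quotient.idealrBE => /asboolP.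
by rewrite -[_ == _]Quotient.idealrBE; apply/asboolP.
Qed.

Definition jacobson_quot_one : Q := \pi_Q 1.
Definition jacobson_quot_mul (a b : Q) : Q := \pi_Q (repr a * repr b).

Lemma pi_jacobson_quot_mul (x y : R) :
  \pi_Q (x * y) = jacobson_quot_mul (\pi_Q x) (\pi_Q y).
Proof.
have [_ JB JMl] := jacobson_left_ideal R.
have [J0 _ JMr] := jacobson_right_ideal R.
have Jrepr (z : R) : jacobson (z - repr (\pi_Q z)).
  by apply/jacobson_quot_eqP; rewrite reprK.
apply/jacobson_quot_eqP.
have := JB _ _ (JMr y _ (Jrepr x))
  (JB _ _ J0 (JMl (repr (\pi_Q x)) _ (Jrepr y))).
by rewrite sub0r opprK mulrBl mulrBr addrA subrK.
Qed.

Let piD (x y : R) : \pi_Q (x + y) = \pi_Q x + \pi_Q y.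
Proof. exact: raddfD. Qed.

Lemma jacobson_quot_mulA : associative jacobson_quot_mul.
Proof.
move=> a b c; rewrite -[a]reprK -[b]reprK -[c]reprK.
move: (repr a) (repr b) (repr c) => x y z.
rewrite -(pi_jacobson_quot_mul x y) -(pi_jacobson_quot_mul y z).
by rewrite -(pi_jacobson_quot_mul x) -(pi_jacobson_quot_mul (x * y)) mulrA.
Qed.

Lemma jacobson_quot_mul1l : left_id jacobson_quot_one jacobson_quot_mul.
Proof. by move=> a; rewrite -[a]reprK -pi_jacobson_quot_mul mul1r. Qed.

Lemma jacobson_quot_mul1r : right_id jacobson_quot_one jacobson_quot_mul.
Proof. by move=> a; rewrite -[a]reprK -pi_jacobson_quot_mul mulr1. Qed.

Lemma jacobson_quot_mulDl : left_distributive jacobson_quot_mul +%R.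
Proof.
move=> a b c; rewrite -[a]reprK -[b]reprK -[c]reprK.
by rewrite -piD -!pi_jacobson_quot_mul -piD mulrDl.
Qed.

Lemma jacobson_quot_mulDr : right_distributive jacobson_quot_mul +%R.
Proof.
move=> a b c; rewrite -[a]reprK -[b]reprK -[c]reprK.
by rewrite -piD -!pi_jacobson_quot_mul -piD mulrDr.
Qed.

HB.instance Definition _ := GRing.Zmodule_isPzRing.Build Q
  jacobson_quot_mulA jacobson_quot_mul1l jacobson_quot_mul1r
  jacobson_quot_mulDl jacobson_quot_mulDr.

Definition jacobson_proj (x : R) : Q := \pi_Q x.

Lemma jacobson_proj_zmod_morphism : zmod_morphism jacobson_proj.
Proof. by move=> x y; rewrite /jacobson_proj raddfB. Qed.

Lemma jacobson_proj_monoid_morphism : monoid_morphism jacobson_proj.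
Proof. by split=> // x y; apply: pi_jacobson_quot_mul. Qed.

HB.instance Definition _ :=
  GRing.isZmodMorphism.Build R Q jacobson_proj jacobson_proj_zmod_morphism.
HB.instance Definition _ :=
  GRing.isMonoidMorphism.Build R Q jacobson_proj jacobson_proj_monoid_morphism.

End JacobsonQuotient.

Section RingClasses.
Variable R : pzRingType.

(* The library's GRing.unit is only available on (nonzero) unitRingType's. *)
Definition units : set R := [set u | exists v, u * v = 1 /\ v * u = 1].

Definition idempotents : set R := [set e | e * e = e].

Definition nilpotents : set R := [set a | exists n : nat, a ^+ n = 0].

Definition quasi_nilpotents : set R :=
  [set a | forall x, a * x = x * a -> units (1 - a * x)].

Definition ring_2UQ : Prop :=
  forall u, units u -> exists e q,
    [/\ idempotents e, quasi_nilpotents q, e * q = q * e & u ^+ 2 = e + q].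

Definition ring_2UJ : Prop :=
  forall u, units u -> exists2 j, jacobson j & u ^+ 2 = 1 + j.

Definition ring_2UU : Prop :=
  forall u, units u -> exists2 q, nilpotents q & u ^+ 2 = 1 + q.

Definition tripotent_ring : Prop := forall a : R, a ^+ 3 = a.

Definition semi_potent_ring : Prop :=
  forall I : set R, left_ideal I \/ right_ideal I ->
    ~ (I `<=` @jacobson R) -> exists e, [/\ I e, idempotents e & e <> 0].

End RingClasses.

Definition idempotents_lift_mod_jacobson (R : pzRingType) : Prop :=
  forall f : jacobson_quot R, idempotents f ->
    exists2 e : R, idempotents e & jacobson_proj e = f.

Definition potent_ring (R : pzRingType) : Prop :=
  semi_potent_ring R /\ idempotents_lift_mod_jacobson R.

(* Main.v *)
Require Import Defs.
From HB Require Import structures.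
From mathcomp Require Import all_boot all_algebra.
From mathcomp Require Import boolp classical_sets.

Set Implicit Arguments.
Unset Strict Implicit.
Unset Printing Implicit Defensive.

Import GRing.Theory.
Local Open Scope ring_scope.
Local Open Scope classical_set_scope.

(** Everything passes through the condition that no nonzero corner [eSe]
contains a unit [u] with [u ^+ 2 - e] also a unit of [eSe].  It holds in every
2-UQ ring, and it descends from [R] to [R / J(R)] when idempotents lift.
Suppose that it holds in a semi-potent ring [S] with zero Jacobson radical.
Then [S] is reduced: a nonzero element of square zero would yield a corner
containing 2x2 matrix units, where the Fibonacci matrix [u] satisfies
[u ^+ 2 - 1 = u].  Hence idempotents of [S] are central, and a nonzero
idempotent in [(a - a ^+ 3) S] would give a corner in which [a] and
[a ^+ 2 - 1] are both invertible; so [a ^+ 3 = a]. *)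

Section UnitsIdempotentsNilpotents.
Variable S : pzRingType.
Implicit Types a e q u v w x y : S.

Lemma units_of_inverses u v w : u * v = 1 -> w * u = 1 -> units u.
Proof.
move=> uv wu; exists v; split=> //.
by rewrite -[v]mul1r -{1}wu -(mulrA w) uv mulr1.
Qed.

Lemma unitsM u v : units u -> units v -> units (u * v).
Proof.
move=> [u' [uu' u'u]] [v' [vv' v'v]]; exists (v' * u'); split.
  by rewrite mulrA -(mulrA u) vv' mulr1.
by rewrite mulrA -(mulrA v') u'u mulr1.
Qed.

Lemma idempotents1B e : idempotents e -> idempotents (1 - e).
Proof.
rewrite /idempotents /= => ee.
by rewrite mulrBr mulr1 mulrBl mul1r ee subrr subr0.
Qed.

Lemma idempotents_units_eq1 e : idempotents e -> units e -> e = 1.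
Proof. by move=> ee [v [ev _]]; rewrite -[LHS]mulr1 -ev mulrA ee. Qed.

Lemma idempotents_units1B_eq0 e : idempotents e -> units (1 - e) -> e = 0.
Proof.
move=> ee /(idempotents_units_eq1 (idempotents1B ee)) e1.
by rewrite -[e](subKr 1) e1 subrr.
Qed.

Lemma idempotents_rmorph (T : pzRingType) (f : {rmorphism S -> T}) e :
  idempotents e -> idempotents (f e).
Proof. by rewrite /idempotents /= -rmorphM => ->. Qed.

Lemma nilpotents_units1B a : nilpotents a -> units (1 - a).
Proof.
move=> [n an0]; have geom : (1 - a) * (\sum_(i < n) a ^+ i) = 1.
  by rewrite -opprB mulNr -subrX1 an0 sub0r opprK.
exists (\sum_(i < n) a ^+ i); split=> //; rewrite -[RHS]geom.
apply: commr_sym; apply: commr_sum => i _; apply: commrX.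
by apply: commr_sym; apply: commrB; [apply: commr1 | ].
Qed.

Lemma nilpotents_quasi_nilpotents : @nilpotents S `<=` @quasi_nilpotents S.
Proof.
move=> q [n qn0] x qx; apply: nilpotents_units1B; exists n.
by rewrite exprMn_comm // qn0 mul0r.
Qed.

End UnitsIdempotentsNilpotents.

Section Ideals.
Variable S : pzRingType.
Implicit Types (I M : set S) (r x : S).

Lemma left_ideal_eqT I : left_ideal I -> I 1 -> I = setT.
Proof.
move=> [_ _ IM] I1; apply/seteqP; split=> // x _.
by rewrite -[x]mulr1; apply: IM.
Qed.

Lemma one_sided_ideal_preimage (T : pzRingType) (f : {rmorphism S -> T})
  (I : set T) : left_ideal I \/ right_ideal I ->
  left_ideal (f @^-1` I) \/ right_ideal (f @^-1` I).
Proof.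
by case=> -[I0 IB IM]; [left | right]; split=> [|x y /= Ix Iy|r x /= Ix] /=;
  rewrite ?rmorph0 ?rmorphB ?rmorphM //; first [exact: IB | exact: IM].
Qed.

Lemma left_ideal_principal x : left_ideal (range (fun r => r * x)).
Proof.
split=> [|_ _ [r _ <-] [s _ <-]|s _ [r _ <-]].
- by exists 0; rewrite ?mul0r.
- by exists (r - s); rewrite ?mulrBl.
- by exists (s * r); rewrite ?mulrA.
Qed.

Lemma right_ideal_principal x : right_ideal (range ( *%R x)).
Proof.
split=> [|_ _ [r _ <-] [s _ <-]|s _ [r _ <-]].
- by exists 0; rewrite ?mulr0.
- by exists (r - s); rewrite ?mulrBr.
- by exists (r * s); rewrite ?mulrA.
Qed.

Lemma left_ideal_add_principal I x : left_ideal I ->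
  left_ideal [set y | exists r, I (y - r * x)].
Proof.
move=> [I0 IB IM]; split=> [|y z [r Iy] [s Iz]|s y [r Iy]].
- by exists 0; rewrite mul0r subrr.
- exists (r - s); have := IB _ _ Iy Iz.
  by rewrite mulrBl !opprD !opprK addrACA.
- by exists (s * r); rewrite -mulrA -mulrBr; apply: IM.
Qed.

Lemma maximal_left_ideal_comaximal M x : maximal_left_ideal M -> ~ M x ->
  exists r, M (1 - r * x).
Proof.
move=> [idM _ maxM] nMx; have [M0 _ _] := idM.
have subK : M `<=` [set y | exists r, M (y - r * x)].
  by move=> y My; exists 0; rewrite mul0r subr0.
have [KM|KT] := maxM _ (left_ideal_add_principal x idM) subK.
  by case: nMx; rewrite -KM; exists 1; rewrite mul1r subrr.
by rewrite -[exists r, _]/([set y | exists r, M (y - r * x)] 1) KT.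
Qed.

Lemma maximal_left_ideal_exists I : left_ideal I -> ~ I 1 ->
  exists2 M, maximal_left_ideal M & I `<=` M.
Proof.
move=> idI nI1.
(* Zorn's lemma also asks for an upper bound of the empty chain, which is the
   empty set. *)
pose proper_above X := [/\ left_ideal X, I `<=` X & ~ X 1].
have [|M [properM maxM]] :=
  @Zorn_bigcup S (fun X => X !=set0 -> proper_above X).
  move=> F properF totF [z [Z FZ Zz]].
  have memF X x : F X -> X x -> proper_above X.
    by move=> FX Xx; apply: properF => //; exists x.
  have [[Z0 _ _] IZ _] := memF _ _ FZ Zz; split.
  - split=> [|x y [X FX Xx] [Y FY Yy]|r x [X FX Xx]]; first by exists Z.
    + have [XY|YX] := totF X Y FX FY.
        have [[_ YB _] _ _] := memF _ _ FY Yy.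
        by exists Y => //; apply: YB => //; apply: XY.
      have [[_ XB _] _ _] := memF _ _ FX Xx.
      by exists X => //; apply: XB => //; apply: YX.
    + have [[_ _ XM] _ _] := memF _ _ FX Xx.
      by exists X => //; apply: XM.
  - by move=> x Ix; exists Z => //; apply: IZ.
  - by move=> [X FX X1]; have [_ _] := memF _ _ FX X1.
have M_neq0 : M !=set0.
  apply: contrapT => /set0P/negP/negPn/eqP M0; have [I0 _ _] := idI.
  apply: (maxM I) => [|_]; last by split.
  by rewrite M0; split=> // /(_ 0 I0).
have [idM IM nM1] := properM M_neq0; exists M => //; split=> //.
  by move=> MT; apply: nM1; rewrite MT.
move=> K idK MK; have [K1|nK1] := pselect (K 1).
  by right; apply: left_ideal_eqT.
left; apply/seteqP; split=> //; apply: contrapT => nKM.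
by apply: (maxM K) => // _; split=> //; apply: subset_trans MK.
Qed.

End Ideals.

Section JacobsonRadical.
Variable S : pzRingType.
Implicit Types e r x : S.

Definition semiprimitive_ring : Prop := forall x, jacobson x -> x = 0.

Lemma jacobson_left_inverse x : jacobson x -> exists v, v * (1 - x) = 1.
Proof.
move=> Jx; apply: contrapT => noinv.
have [|M maxM IM] :=
  maximal_left_ideal_exists (left_ideal_principal (1 - x)).
  by move=> [v _ v1]; apply: noinv; exists v.
have [idM MT _] := maxM; have [M0 MB _] := idM.
apply/MT/left_ideal_eqT => //.
have M1x : M (1 - x) by apply: IM; exists 1; rewrite ?mul1r.
have := MB _ _ M1x (MB _ _ M0 (Jx M maxM)).
by rewrite sub0r opprK subrK.
Qed.

Lemma jacobson_units1B x : jacobson x -> units (1 - x).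
Proof.
move=> Jx; have [v v1] := jacobson_left_inverse Jx.
have [J0 JB JM] := jacobson_left_ideal S.
have [|w] := @jacobson_left_inverse (- (v * x)).
  by rewrite -sub0r; apply: JB => //; apply: JM.
have -> : 1 - - (v * x) = v.
  by rewrite opprK -v1 mulrBr mulr1 subrK.
move=> wv; have [v' [vv' v'v]] : units v by apply: units_of_inverses v1 wv.
by exists v; split=> //; rewrite -[1 - x]mul1r -{1}v'v -(mulrA v') v1 mulr1.
Qed.

Lemma jacobsonP x : jacobson x <-> forall r, units (1 - r * x).
Proof.
split=> [Jx r|ux M maxM].
  by apply: jacobson_units1B; have [_ _ JM] := jacobson_left_ideal S; apply: JM.
apply: contrapT => /(maximal_left_ideal_comaximal maxM)[r Mr].
have [idM MT _] := maxM; have [_ _ MM] := idM.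
have [v [_ v1]] := ux r.
by apply/MT/left_ideal_eqT => //; rewrite -v1; apply: MM.
Qed.

Lemma jacobson_quasi_nilpotents : @jacobson S `<=` @quasi_nilpotents S.
Proof.
move=> j Jj x _; apply: jacobson_units1B.
by have [_ _ JM] := jacobson_right_ideal S; apply: JM.
Qed.

Lemma jacobson_idempotents_eq0 e : jacobson e -> idempotents e -> e = 0.
Proof. by move=> /jacobson_units1B ue ee; apply: idempotents_units1B_eq0. Qed.

Lemma semi_potent_principal_idempotent x :
  semi_potent_ring S -> semiprimitive_ring -> x <> 0 ->
  exists2 r, idempotents (x * r) & x * r <> 0.
Proof.
move=> spS J0 x0.
have [|_ [[r _ <-] ee e0]] := spS _ (or_intror (right_ideal_principal x)).
  by move=> subJ; apply: x0; apply: J0; apply: subJ; exists 1; rewrite ?mulr1.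
by exists r.
Qed.

End JacobsonRadical.

Section TwoUnitRings.
Variable S : pzRingType.
Implicit Types (A : set S) (e q u x y : S).

Lemma exists2_addrP A x y : (exists2 q, A q & x = y + q) <-> A (x - y).
Proof.
split=> [[q Aq ->]|Axy]; first by rewrite addrAC subrr add0r.
by exists (x - y) => //; rewrite addrC subrK.
Qed.

Lemma units_idempotent_quasi_nilpotent_eq1 e q : idempotents e ->
  quasi_nilpotents q -> e * q = q * e -> units (e + q) -> e = 1.
Proof.
move=> ee qnq eq ueq; apply: idempotents_units_eq1 => //.
have [v [uv vu]] := ueq; have uq : (e + q) * q = q * (e + q).
  by rewrite mulrDl mulrDr eq.
have qv : q * v = v * q.
  by rewrite -[LHS]mul1r -vu -mulrA (mulrA _ q v) uq -mulrA uv mulr1.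
have -> : e = (1 - q * v) * (e + q).
  by rewrite mulrBl mul1r -mulrA vu mulr1 addrK.
exact: unitsM (qnq _ qv) ueq.
Qed.

Lemma ring_2UQP :
  ring_2UQ S <-> forall u, units u -> quasi_nilpotents (u ^+ 2 - 1).
Proof.
split=> [S2UQ u uu|qnS u /qnS qnu].
  have [e [q [ee qnq eq u2]]] := S2UQ u uu.
  have e1 : e = 1.
    apply: units_idempotent_quasi_nilpotent_eq1 qnq eq _ => //.
    by rewrite -u2 expr2; apply: unitsM.
  by apply/exists2_addrP; exists q; rewrite // -e1.
exists 1, (u ^+ 2 - 1); split=> //; last by rewrite addrC subrK.
  by rewrite /idempotents /= mulr1.
by rewrite mul1r mulr1.
Qed.

Lemma ring_2UJ_2UQ : ring_2UJ S -> ring_2UQ S.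
Proof.
move=> S2UJ; apply/ring_2UQP => u /S2UJ/exists2_addrP.
exact: jacobson_quasi_nilpotents.
Qed.

Lemma ring_2UU_2UQ : ring_2UU S -> ring_2UQ S.
Proof.
move=> S2UU; apply/ring_2UQP => u /S2UU/exists2_addrP.
exact: nilpotents_quasi_nilpotents.
Qed.

Lemma semiprimitive_2UJ_2UU : semiprimitive_ring S -> ring_2UJ S -> ring_2UU S.
Proof.
move=> J0 S2UJ u /S2UJ[j /J0 -> ->]; exists 0 => //.
by exists 1%N; rewrite expr1.
Qed.

Lemma tripotent_units_sqr u : tripotent_ring S -> units u -> u ^+ 2 = 1.
Proof.
by move=> S3 [v [uv _]]; rewrite -[LHS]mulr1 -uv mulrA -exprSr S3.
Qed.

Lemma tripotent_2UJ : tripotent_ring S -> ring_2UJ S.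
Proof.
move=> S3 u /(tripotent_units_sqr S3) ->; exists 0; last by rewrite addr0.
by have [] := jacobson_left_ideal S.
Qed.

End TwoUnitRings.

Section Corners.
Variable S : pzRingType.
Implicit Types e u v x y : S.

(* For an idempotent [e], this is the ring [eSe], whose unit element is [e]. *)
Definition corner e : set S := [set x | e * x = x /\ x * e = x].

Definition corner_units e : set S :=
  [set u | corner e u /\ exists v, [/\ corner e v, u * v = e & v * u = e]].

Lemma corner_idempotent e : idempotents e -> corner e e.
Proof. by []. Qed.

Lemma cornerB e x y : corner e x -> corner e y -> corner e (x - y).
Proof.
by move=> [ex xe] [ey ye]; split; rewrite ?mulrBl ?mulrBr ?ex ?xe ?ey ?ye.
Qed.

Lemma cornerX e x n : corner e x -> corner e (x ^+ n.+1).
Proof.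
by move=> [ex xe]; split; [rewrite exprS mulrA ex | rewrite exprSr -mulrA xe].
Qed.

Lemma corner_compress e x : idempotents e -> corner e (e * x * e).
Proof. by move=> ee; split; rewrite ?mulrA ?ee // -mulrA ee. Qed.

Lemma corner_mul1B e x : corner e x -> x * (1 - e) = 0.
Proof. by move=> [_ xe]; rewrite mulrBr mulr1 xe subrr. Qed.

Lemma corner_1Bmul e x : corner e x -> (1 - e) * x = 0.
Proof. by move=> [ex _]; rewrite mulrBl mul1r ex subrr. Qed.

Lemma corner_add1BM e x y : idempotents e -> corner e x -> corner e y ->
  (x + (1 - e)) * (y + (1 - e)) = x * y + (1 - e).
Proof.
move=> ee cx cy; rewrite mulrDl mulrDr [(1 - e) * _]mulrDr (idempotents1B ee).
by rewrite (corner_mul1B cx) (corner_1Bmul cy) addr0 add0r.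
Qed.

Lemma corner_units_add1BP e u : idempotents e -> corner e u ->
  corner_units e u <-> units (u + (1 - e)).
Proof.
move=> ee cu; have [eu ue] := cu; have ce := corner_idempotent ee.
split=> [[_ [v [cv uv vu]]]|[w [uw wu]]].
  exists (v + (1 - e)).
  by rewrite !corner_add1BM // uv vu addrC subrK.
have {}uw : u * w = e.
  by rewrite -[RHS]mulr1 -uw mulrA mulrDr eu (corner_mul1B ce) addr0.
have {}wu : w * u = e.
  by rewrite -[RHS]mul1r -wu -mulrA mulrDl ue (corner_1Bmul ce) addr0.
split=> //; exists (e * w * e); split; first exact: corner_compress.
  by rewrite !mulrA ue uw ee.
by rewrite -mulrA eu -mulrA wu ee.
Qed.

Definition reduced_ring : Prop := forall x, x * x = 0 -> x = 0.

Definition abelian_ring : Prop :=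
  forall e, idempotents e -> forall x, e * x = x * e.

Lemma reduced_abelian : reduced_ring -> abelian_ring.
Proof.
move=> red e ee x; have ce := corner_idempotent ee.
have : e * x * (1 - e) = 0.
  by apply: red; rewrite -!mulrA (mulrA _ e) (corner_1Bmul ce) mul0r !mulr0.
have : (1 - e) * x * e = 0.
  apply: red; rewrite -!mulrA (mulrA e (1 - e)) (corner_mul1B ce).
  by rewrite mul0r !mulr0.
by rewrite mulrBl mul1r mulrBl mulrBr mulr1 => /subr0_eq -> /subr0_eq.
Qed.

Lemma abelian_corner_units e x y : abelian_ring -> idempotents e ->
  x * y = e -> corner_units e (x * e).
Proof.
move=> ab ee xy; have eC := ab e ee.
have ce z : corner e (z * e) by split; rewrite ?eC -mulrA ee.
split=> //; exists (y * e); split=> //.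
  by rewrite -mulrA (mulrA e) eC -!mulrA ee mulrA xy ee.
have xey : x * e * y = e by rewrite -eC -mulrA xy ee.
have yxe_idem : idempotents (y * x * e).
  rewrite /idempotents /= -!mulrA [x * (e * _)]mulrA (mulrA _ y) xey.
  by rewrite (mulrA e) eC -mulrA ee.
have -> : y * e * (x * e) = y * x * e.
  by rewrite -mulrA eC -(mulrA x) ee mulrA.
transitivity (y * x * e * (x * y)); first by rewrite xy -(mulrA _ e) ee.
by rewrite mulrA (ab _ yxe_idem) !mulrA xy -(mulrA e) -(mulrA e) xey ee.
Qed.

End Corners.

Section NoCornerUnitSqrB1.
Variable S : pzRingType.
Implicit Types e u x y : S.

Definition no_corner_unit_sqrB1 : Prop :=
  forall e u, idempotents e -> corner_units e u ->
    corner_units e (u ^+ 2 - e) -> e = 0.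

Lemma ring_2UQ_no_corner_unit_sqrB1 : ring_2UQ S -> no_corner_unit_sqrB1.
Proof.
move=> /ring_2UQP qnS e u ee cuu [_ [w [_ qw wq]]]; have [cu _] := cuu.
have qnq : quasi_nilpotents ((u + (1 - e)) ^+ 2 - 1).
  by apply: qnS; apply/corner_units_add1BP.
apply: idempotents_units1B_eq0 => //; rewrite -qw.
have qE : (u + (1 - e)) ^+ 2 - 1 = u ^+ 2 - e.
  by rewrite expr2 corner_add1BM // -expr2 addrA addrAC addrK.
by rewrite qE in qnq; apply: qnq; rewrite qw wq.
Qed.

Lemma golden_corner_eq0 e u : no_corner_unit_sqrB1 -> corner e u ->
  u ^+ 2 = u + e -> e = 0.
Proof.
move=> noS cu u2; have [eu ue] := cu.
have eE : e = u ^+ 2 - u by rewrite u2 addrAC subrr add0r.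
have ee : idempotents e by rewrite /idempotents /= {2}eE mulrBr expr2 mulrA eu.
have cuu : corner_units e u.
  split=> //; exists (u - e); split; first exact: cornerB.
    by rewrite mulrBr ue -expr2 -eE.
  by rewrite mulrBl eu -expr2 -eE.
by apply: (noS e u) => //; rewrite u2 addrK.
Qed.

(* [x] and [y] are off-diagonal 2x2 matrix units in the corner of
   [x * y + y * x], so that [x * y + x + y] is the Fibonacci matrix. *)
Lemma matrix_units_eq0 x y : no_corner_unit_sqrB1 -> x * x = 0 -> y * y = 0 ->
  x * y * x = x -> y * x * y = y -> x = 0.
Proof.
move=> noS xx yy xyx yxy.
have zxx z : z * x * x = 0 by rewrite -mulrA xx mulr0.
have zyy z : z * y * y = 0 by rewrite -mulrA yy mulr0.
pose simp := (xyx, yxy, zxx, zyy, xx, yy, mul0r, addr0, add0r).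
have e0 : x * y + y * x = 0.
  apply: (@golden_corner_eq0 _ (x * y + x + y)) => //.
  - by split; rewrite !mulrDl !mulrDr !mulrA !simp.
  - by rewrite expr2 !mulrDl !mulrDr !mulrA !simp addrACA.
by rewrite -[LHS]addr0 -(zxx y) -{1}xyx -mulrDl e0 mul0r.
Qed.

Lemma no_corner_unit_sqrB1_reduced :
  semi_potent_ring S -> semiprimitive_ring S -> no_corner_unit_sqrB1 ->
  reduced_ring S.
Proof.
move=> spS J0 noS a aa; apply: contrapT.
move=> /(semi_potent_principal_idempotent spS J0)[r].
move arE: (a * r) => e ee; apply.
have ce := corner_idempotent ee.
have ae : a * e = 0 by rewrite -arE mulrA aa mul0r.
pose x := e * a; pose y := (1 - e) * r * e.
have xy : x * y = e.
  rewrite /x /y !mulrA mulrBr mulr1 -(mulrA e a e) ae mulr0 subr0.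
  by rewrite -(mulrA e a r) arE !ee.
have x0 : x = 0.
  apply: (@matrix_units_eq0 _ y) => //.
  - by rewrite mulrA -(mulrA e) ae mulr0 mul0r.
  - by rewrite !mulrA -(mulrA _ e) (corner_mul1B ce) mulr0 !mul0r.
  - by rewrite xy mulrA ee.
  - by rewrite -mulrA xy -mulrA ee.
by rewrite -xy x0 mul0r.
Qed.

Lemma no_corner_unit_sqrB1_tripotent :
  semi_potent_ring S -> semiprimitive_ring S -> no_corner_unit_sqrB1 ->
  tripotent_ring S.
Proof.
move=> spS J0 noS a.
have ab := reduced_abelian (no_corner_unit_sqrB1_reduced spS J0 noS).
apply: contrapT => a3.
have /(semi_potent_principal_idempotent spS J0)[r] : a - a ^+ 3 <> 0.
  by move=> /subr0_eq/esym.
move aarE: (_ * r) => e ee; apply.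
apply: (noS e (a * e)) => //.
  apply: (@abelian_corner_units _ _ _ ((1 - a ^+ 2) * r)) => //.
  by rewrite mulrA mulrBr mulr1 -exprS.
have -> : (a * e) ^+ 2 - e = (a ^+ 2 - 1) * e.
  rewrite exprMn_comm; last exact: commr_sym (ab e ee a).
  by rewrite (expr2 e) ee mulrBl mul1r.
apply: (@abelian_corner_units _ _ _ (- (a * r))) => //.
by rewrite mulrN -mulNr opprB mulrA mulrBl mul1r -exprSr.
Qed.

End NoCornerUnitSqrB1.

Section JacobsonQuotient.
Variable R : pzRingType.
Implicit Types e u x : R.
Local Notation Q := (jacobson_quot R).
Local Notation proj := (@jacobson_proj R).

Lemma jacobson_proj_surj (a : Q) : exists x, proj x = a.
Proof. by exists (repr a); apply: reprK. Qed.

Lemma jacobson_proj_eq0 x : proj x = 0 <-> jacobson x.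
Proof. by rewrite -(rmorph0 proj) /jacobson_proj jacobson_quot_eqP subr0. Qed.

Lemma jacobson_proj_eq1_units x : proj x = 1 -> units x.
Proof.
move=> x1; rewrite -[x](subKr 1); apply: jacobson_units1B.
by apply/jacobson_proj_eq0; rewrite rmorphB rmorph1 /= x1 subrr.
Qed.

Lemma jacobson_proj_units u : units (proj u) <-> units u.
Proof.
split=> [[a [ua au]]|[v [uv vu]]]; last first.
  by exists (proj v); rewrite -!rmorphM uv vu rmorph1.
have [v va] := jacobson_proj_surj a; rewrite -va -!rmorphM in ua au.
have [s [uvs1 _]] := jacobson_proj_eq1_units ua.
have [t [_ tvu1]] := jacobson_proj_eq1_units au.
by apply: (@units_of_inverses _ _ (v * s) (t * v)); rewrite ?mulrA // -mulrA.
Qed.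

Lemma jacobson_quot_semiprimitive : semiprimitive_ring Q.
Proof.
move=> a; have [x <-] := jacobson_proj_surj a => /jacobsonP Jx.
apply/jacobson_proj_eq0/jacobsonP => r; apply/jacobson_proj_units.
by rewrite rmorphB rmorph1 rmorphM.
Qed.

Lemma jacobson_projP x : jacobson (proj x) <-> jacobson x.
Proof.
split=> [Jx|/jacobson_proj_eq0 ->].
  exact/jacobson_proj_eq0/jacobson_quot_semiprimitive.
by have [] := jacobson_left_ideal Q.
Qed.

Lemma ring_2UJ_jacobson_quot : ring_2UJ Q <-> ring_2UJ R.
Proof.
have projE u : proj (u ^+ 2 - 1) = proj u ^+ 2 - 1.
  by rewrite rmorphB rmorphXn rmorph1.
split=> [Q2UJ u /jacobson_proj_units/Q2UJ/exists2_addrP|R2UJ a].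
  by rewrite -projE => /jacobson_projP/exists2_addrP.
have [u <-] := jacobson_proj_surj a => /jacobson_proj_units/R2UJ/exists2_addrP.
by move=> Ju; apply/exists2_addrP; rewrite -projE; apply/jacobson_projP.
Qed.

Lemma semi_potent_jacobson_quot : semi_potent_ring R -> semi_potent_ring Q.
Proof.
move=> spR I /(one_sided_ideal_preimage proj) idI nIJ.
have [|e [Ie ee e0]] := spR _ idI.
  move=> IJ; apply: nIJ => a; have [x <-] := jacobson_proj_surj a => Ix.
  by apply/jacobson_projP; apply: IJ.
exists (proj e); split=> //; first exact: idempotents_rmorph.
by move=> /jacobson_proj_eq0 Je; apply: e0; exact: jacobson_idempotents_eq0.
Qed.

Lemma jacobson_proj_corner_units e u : idempotents e -> corner e u ->
  corner_units (proj e) (proj u) -> corner_units e u.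
Proof.
move=> ee cu cuu; apply/(corner_units_add1BP ee cu)/jacobson_proj_units.
have [cpu _] := cuu; rewrite rmorphD rmorphB rmorph1 /=.
by apply/corner_units_add1BP => //; apply: idempotents_rmorph.
Qed.

Lemma no_corner_unit_sqrB1_jacobson_quot : idempotents_lift_mod_jacobson R ->
  no_corner_unit_sqrB1 R -> no_corner_unit_sqrB1 Q.
Proof.
move=> lift noR _ a /lift[e ee <-]; have [x <-] := jacobson_proj_surj a.
move=> cuu cuq; have [[ex xe] _] := cuu.
have projE : proj (e * x * e) = proj x by rewrite !rmorphM ex xe.
rewrite -projE in cuu cuq; have cx := corner_compress x ee.
rewrite (_ : e = 0) ?rmorph0 //; apply: (noR e (e * x * e)) => //.
  exact: jacobson_proj_corner_units.
apply: jacobson_proj_corner_units => //; last by rewrite rmorphB rmorphXn.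
by apply: cornerB; [apply: cornerX | apply: corner_idempotent].
Qed.

Lemma no_corner_unit_sqrB1_jacobson_quot_tripotent :
  semi_potent_ring R -> no_corner_unit_sqrB1 Q -> tripotent_ring Q.
Proof.
move=> spR; apply: no_corner_unit_sqrB1_tripotent.
  exact: semi_potent_jacobson_quot.
exact: jacobson_quot_semiprimitive.
Qed.

Lemma semi_potent_2UQ_jacobson_quot_tripotent :
  semi_potent_ring R -> ring_2UQ Q -> tripotent_ring Q.
Proof.
move=> spR /ring_2UQ_no_corner_unit_sqrB1.
exact: no_corner_unit_sqrB1_jacobson_quot_tripotent.
Qed.

Lemma potent_2UQ_jacobson_quot_tripotent :
  potent_ring R -> ring_2UQ R -> tripotent_ring Q.
Proof.
move=> [spR lift] /ring_2UQ_no_corner_unit_sqrB1.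
move=> /(no_corner_unit_sqrB1_jacobson_quot lift).
exact: no_corner_unit_sqrB1_jacobson_quot_tripotent.
Qed.

End JacobsonQuotient.

Theorem theorem3p5 (R : pzRingType) (hR : potent_ring R) :
  [<-> ring_2UQ R;
       ring_2UQ (jacobson_quot R);
       tripotent_ring (jacobson_quot R);
       ring_2UJ R;
       ring_2UJ (jacobson_quot R);
       ring_2UU (jacobson_quot R)].
Proof.
have [spR _] := hR; have J0 := @jacobson_quot_semiprimitive R; tfae.
- by move=> /(potent_2UQ_jacobson_quot_tripotent hR)/tripotent_2UJ/ring_2UJ_2UQ.
- exact: semi_potent_2UQ_jacobson_quot_tripotent.
- by move=> /tripotent_2UJ/ring_2UJ_jacobson_quot.
- by move=> /ring_2UJ_jacobson_quot.
- exact: semiprimitive_2UJ_2UU.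
- move=> /ring_2UU_2UQ/(semi_potent_2UQ_jacobson_quot_tripotent spR).
  by move=> /tripotent_2UJ/ring_2UJ_jacobson_quot/ring_2UJ_2UQ.
Qed.
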